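(* For each $n\in\mathbb{N}$ let $\ell=\ell(n)\in\mathbb{N}$ be a positive integer and let $t_1=t_1(n),\dots,t_\ell=t_\ell(n)$ be positive integers, such that $\ell=o(\log n)$ and $\sup_{i} t_i=n^{o(1)}$ as $n\to\infty$. Then $$R(K_{t_1,\dots,t_\ell},Q_n)\le n\left(1+\frac{2+o(1)}{\log n}\right)^\ell\le n+\frac{\big(2+o(1)\big)\ell n}{\log n}.$$ That is, there exist functions $\varepsilon_1,\varepsilon_2\colon\mathbb{N}\to\mathbb{R}$ with $\varepsilon_1(n)\to0$ and $\varepsilon_2(n)\to 0$ as $n\to\infty$ (depending only on the given choice of parameters $\ell(n)$ and $t_i(n)$) such that for all $n\ge 2$, $$R(K_{t_1,\dots,t_\ell},Q_n)\le n\left(1+\frac{2+\varepsilon_1(n)}{\log n}\right)^\ell\le n+\frac{\big(2+\varepsilon_2(n)\big)\ell n}{\log n}.$$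
   Context: $\mathbb{N}$ is the set of positive integers and $\log$ is the logarithm to base $2$. All asymptotic notation is with respect to $n\to\infty$: $f(n)=o(g(n))$ means $f(n)/g(n)\to0$, and $f(n)=n^{o(1)}$ means $\log f(n)/\log n\to 0$. For $n\in\mathbb{N}$, the Boolean lattice $Q_n$ of dimension $n$ is the poset of all subsets of an $n$-element ground set ordered by inclusion. A poset $P_1$ is an induced subposet of a poset $P_2$ if $P_1\subseteq P_2$ and for all $X,Y\in P_1$, $X\le_{P_1}Y$ if and only if $X\le_{P_2}Y$. A copy of $P_1$ in $P_2$ is an induced subposet of $P_2$ isomorphic to $P_1$. A blue/red coloring of a poset $P$ is a map $P\to\{\text{blue},\text{red}\}$ coloring its elements; a copy is blue (red) if all its elements are blue (red). The poset Ramsey number $R(P,Q)$ is the smallest $N\in\mathbb{N}$ such that every blue/red coloring of $Q_N$ contains a blue copy of $P$ or a red copy of $Q$. The complete $\ell$-partite poset $K_{t_1,\dots,t_\ell}$ is the poset on $\sum_{i=1}^\ell t_i$ elements consisting of pairwise disjoint layers $A^1,\dots,A^\ell$ with $|A^i|=t_i$, where for any $i,j\in\{1,\dots,\ell\}$ and $X\in A^i$, $Y\in A^j$, one has $X<Y$ if and only if $i<j$. *)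

(* Defs.v *)
From HB Require Import structures.
From mathcomp Require Import all_boot all_order all_algebra.
From mathcomp Require Import boolp reals exp.

Set Implicit Arguments.
Unset Strict Implicit.
Unset Printing Implicit Defensive.

Import Order.TTheory GRing.Theory Num.Theory.
Import Order.DefaultSetSubsetOrder.

Local Open Scope order_scope.

Definition log2 (R : realType) (x : R) : R := (ln x / ln 2)%R.

Definition boolean_lattice (n : nat) : Type := {set 'I_n}.

HB.instance Definition _ (n : nat) := Finite.on (boolean_lattice n).
HB.instance Definition _ (n : nat) := Order.POrder.on (boolean_lattice n).

Fact le_boolean_latticeE n (A B : boolean_lattice n) :
  (A <= B) = (A \subset B).
Proof. by []. Qed.

(* An element of the complete l-partite poset with layer sizes t is a pair
   (i, a) with i < l and a < t i; the layers are indexed from 0. *)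
Definition multipartite (l : nat) (t : 'I_l -> nat) : Type :=
  {i : 'I_l & 'I_(t i)}.

HB.instance Definition _ (l : nat) (t : 'I_l -> nat) :=
  Finite.on (multipartite t).

Section MultipartiteOrder.
Context (l : nat) (t : 'I_l -> nat).

Definition multipartite_lt (x y : multipartite t) : bool := (tag x < tag y)%N.

Fact multipartite_lt_irr : irreflexive multipartite_lt.
Proof. by move=> x; exact: ltnn. Qed.

Fact multipartite_lt_trans : transitive multipartite_lt.
Proof. by move=> y x z; exact: ltn_trans. Qed.

Fact multipartite_display : Order.disp_t. Proof. exact. Qed.

HB.instance Definition _ :=
  Order.Lt_isPOrder.Build multipartite_display (multipartite t)
    multipartite_lt_irr multipartite_lt_trans.

Fact lt_multipartiteE (x y : multipartite t) : (x < y) = (tag x < tag y)%N.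
Proof. by []. Qed.

Fact le_multipartiteE (x y : multipartite t) :
  (x <= y) = (x == y) || (tag x < tag y)%N.
Proof. by []. Qed.

End MultipartiteOrder.

Variant color := Blue | Red.

(* A map that preserves and reflects <= is injective, hence an isomorphism onto
   its range. *)
Definition is_copy d (P : finPOrderType d) d' (Q : finPOrderType d')
    (S : {set Q}) : Prop :=
  exists2 f : P -> Q, {mono f : x y / x <= y} & S = [set f x | x in P].

Definition ramsey_arrow d1 (P : finPOrderType d1) d2 (Q : finPOrderType d2)
    (N : nat) : Prop :=
  forall c : boolean_lattice N -> color,
    (exists2 S : {set boolean_lattice N},
       is_copy P S & forall X, X \in S -> c X = Blue) \/
    (exists2 S : {set boolean_lattice N},
       is_copy Q S & forall X, X \in S -> c X = Red).

(* Ground set: one label for each element of Q, and #|Q| + 1 disjoint blocks, each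
   a copy of P. Assign to q the sets whose labels form the down-set D of q, which
   contain all blocks of index < #|D| and a subset of the block of index #|D|. If
   no q has only blue sets, then choosing a red set for each q gives a copy of Q. *)
Fact ramsey_arrow_ex d1 (P : finPOrderType d1) d2 (Q : finPOrderType d2) :
  exists N, `[< (0 < N)%N /\ ramsey_arrow P Q N >].
Proof.
pose G := option (Q + 'I_#|Q|.+1 * P)%type.
exists #|{: G}|; apply/asboolP; split=> [|c]; first by rewrite card_option.
pose down (q : Q) := [set x | x <= q].
pose B (q : Q) (A : {set P}) : {set G} := [set g : G |
  match g with
  | Some (inl x) => x <= q
  | Some (inr (j, x)) =>
      (j < #|down q|)%N || (j == #|down q| :> nat) && (x \in A)
  | None => false
  end].
pose h (S : {set G}) : boolean_lattice #|{: G}| := enum_rank @: S.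
have hE S T : (h S <= h T) = (S \subset T).
  apply/idP/idP => [|ST]; last exact: imsetS.
  move=> /subsetP hST; apply/subsetP => g gS.
  have /hST/imsetP[g' g'T /enum_rank_inj ->//] : enum_rank g \in h S.
  exact: imset_f.
have downS q q' : q < q' -> (#|down q| < #|down q'|)%N.
  move=> qq'; apply: proper_card; apply/properP; split.
    by apply/subsetP => x; rewrite !inE => /le_trans; apply; exact: ltW.
  by exists q'; rewrite inE ?lexx ?lt_geF.
have downQ q : (#|down q| < #|Q|.+1)%N by rewrite ltnS max_card.
have [[q qB]|nB] := pselect (exists q, forall A, c (h (B q A)) = Blue).
  left; pose f (p : P) := h (B q [set x | x <= p]).
  exists [set f p | p in P]; last by move=> _ /imsetP[p _ ->]; exact: qB.
  exists f => // p p'; rewrite /f hE; apply/subsetP/idP => [sub|pp'].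
    have := sub (Some (inr (Ordinal (downQ q), p))).
    by rewrite !inE /= ltnn eqxx /= lexx => /(_ isT).
  move=> [[x|[j x]]|]; rewrite !inE //= => /orP[->//|/andP[-> xp]].
  by rewrite (le_trans xp pp') orbT.
have /choice[a aR] q : exists A, c (h (B q A)) = Red.
  apply: contrapT => nR; apply: nB; exists q => A.
  by case cE: (c _) => //; case: nR; exists A.
right; pose f q := h (B q (a q)).
exists [set f q | q in Q]; last by move=> _ /imsetP[q _ ->]; exact: aR.
exists f => // q q'; rewrite /f hE; apply/subsetP/idP => [sub|].
  by have := sub (Some (inl q)); rewrite !inE lexx; exact.
rewrite le_eqVlt => /predU1P[->//|qq'].
move=> [[x|[j x]]|]; rewrite !inE //=.
  by move=> /le_trans; apply; exact: ltW.
have dd := downS _ _ qq'.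
by move=> /orP[jq|/andP[/eqP-> _]]; rewrite ?dd// (ltn_trans jq dd).
Qed.

Definition poset_ramsey d1 (P : finPOrderType d1) d2 (Q : finPOrderType d2)
  : nat := ex_minn (ramsey_arrow_ex P Q).

(* Main.v *)
Require Import Defs.
From mathcomp Require Import boolp classical_sets reals topology normedtype.
From mathcomp Require Import sequences exp.
From mathcomp Require Import all_boot all_order all_algebra fingroup perm.
From mathcomp Require Import ring lra.

Set Implicit Arguments.
Unset Strict Implicit.
Unset Printing Implicit Defensive.

Import Order.TTheory GRing.Theory Num.Theory.
Import numFieldNormedType.Exports.

(** Call the blue sets [S]. Split the ground set of [Q_(m + k)] into [m] old and
    [k] new elements. If no copy of [Q_m] avoids [S], then for every order in
    which the new elements may be added there is a chain in [S] whose members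
    meet the new elements exactly in the successive initial segments of that
    order ([cube_or_chain]): otherwise, a greedy choice of initial segments would
    complete every set of old elements to a set outside [S], monotonically.

    There are [k!] orders, but at most [4 ^ m] possibilities for the two ends of
    a chain. If [4 ^ m * s ^ (k + 1) < k!], then among the chains with some common
    pair of ends more than [s] initial segments of one size occur, and sets with
    different initial segments of the same size are incomparable. Hence [S]
    contains a spindle: a bottom, an antichain of [s + 1] sets and a top
    ([cube_or_spindle]).

    Spindles are glued by recolouring ([layeredS]). Keep as blue only the set [T]
    of tops of blue spindles. As [S :\: T] contains no spindle, a whole cube
    [Q_m] avoids it, and in this cube blue means: top of a blue spindle. A red
    [Q_n] in the smaller recoloured cube is really red, and a structure in [T]
    can be extended downwards by a spindle below its bottom. After [l] rounds the
    antichains form [l] layers that contain the complete multipartite poset, and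
    the dimension has been built up from [n] by [l] steps [m |-> m + k m].

    Since [log k!] is about [k log k], the choice [k m ~ (2 + d) m / log n] is
    large enough for all [m >= n] when [n] is large, provided that
    [log s = o(log n)] ([step_large]). So the dimension is at most
    [n (1 + (2 + d) / log n) ^ l] for each [d > 0] and large [n], and a choice of
    [eps1] as small as the inequality allows tends to [0]. The second inequality
    is the comparison of [(1 + x) ^ l] with [1 + l x] when [l x] tends to [0],
    which is where [l = o(log n)] enters. *)

(** * Red cubes, spindles and the chain argument *)

Definition cube_avoiding m N (S : {set {set 'I_N}}) : Prop :=
  exists2 f : {set 'I_m} -> {set 'I_N},
    {mono f : A B / A \subset B} & forall A, f A \notin S.

Definition antichain w N (a : 'I_w -> {set 'I_N}) : Prop :=
  forall i j, a i \subset a j -> i = j.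

(** For [w >= 2] the antichain condition makes the weak inclusions strict, so this
    is a copy in [S] of the complete tripartite poset with layer sizes
    [1], [w] and [1]. *)
Definition spindle w N (S : {set {set 'I_N}}) (b c : {set 'I_N})
    (a : 'I_w -> {set 'I_N}) : Prop :=
  [/\ [/\ b \in S, c \in S & forall j, a j \in S],
      forall j, b \subset a j, forall j, a j \subset c & antichain a].

Section Join.
Context (m k : nat).

(** The set with trace [A] on the old elements and trace [B] on the new ones. *)
Definition join (A : {set 'I_m}) (B : {set 'I_k}) : {set 'I_(m + k)} :=
  (@lshift m k @: A) :|: (@rshift m k @: B).

Lemma mem_join_l A B i : (lshift k i \in join A B) = (i \in A).
Proof.
rewrite inE mem_imset; last exact: lshift_inj.
case: (i \in A) => //=; apply/negbTE/imsetP => -[j _ /eqP].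
by rewrite eq_lrshift.
Qed.

Lemma mem_join_r A B j : (rshift m j \in join A B) = (j \in B).
Proof.
rewrite inE orbC mem_imset; last exact: rshift_inj.
case: (j \in B) => //=; apply/negbTE/imsetP => -[i _ /eqP].
by rewrite eq_rlshift.
Qed.

Lemma join_subset A B C D :
  (join A B \subset join C D) = (A \subset C) && (B \subset D).
Proof.
apply/idP/andP => [/subsetP sub|[AC BD]]; last first.
  by rewrite setUSS ?imsetS.
split; apply/subsetP => i.
  by rewrite -(mem_join_l A B) => /sub; rewrite mem_join_l.
by rewrite -(mem_join_r A B) => /sub; rewrite mem_join_r.
Qed.

(** Greedy climb: [A] is sent to [join A (P r)] with [r] the length of the
    longest chain in [S] through levels [0, ..., r - 1] that stays below [A].
    Maximality of [r] puts the image outside [S], monotonicity of [r] in [A]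
    makes the map an embedding, and only a chain through all the levels stops
    the construction. *)
Lemma cube_or_chain (S : {set {set 'I_(m + k)}}) (P : nat -> {set 'I_k})
    (P_homo : {homo P : i j / (i <= j)%N >-> i \subset j}) :
  cube_avoiding m S \/
  exists A : nat -> {set 'I_m},
    {in [pred i | (i <= k)%N] &, {homo A : i j / (i <= j)%N >-> i \subset j}} /\
    forall i, (i <= k)%N -> join (A i) (P i) \in S.
Proof.
pose climb := fix climb r (A : {set 'I_m}) : bool :=
  if r is r'.+1 then
    [exists B : {set 'I_m}, [&& B \subset A, climb r' B & join B (P r') \in S]]
  else true.
have climbS r (A B : {set 'I_m}) : A \subset B -> climb r A -> climb r B.
  case: r => //= r AB /existsP[C /and3P[CA cC CS]].
  by apply/existsP; exists C; rewrite (subset_trans CA AB) cC.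
have climbW r A : climb r.+1 A -> climb r A.
  by move=> /existsP[B /and3P[BA cB _]]; exact: climbS BA cB.
have climb_le r r' A : (r <= r')%N -> climb r' A -> climb r A.
  move=> /subnK<-; elim: (r' - r)%N => // d IH; rewrite addSn => c.
  exact/IH/climbW.
have climb_chain r A : climb r A -> exists C : nat -> {set 'I_m},
    [/\ {in [pred i | (i < r)%N] &,
          {homo C : i j / (i <= j)%N >-> i \subset j}},
        forall i, (i < r)%N -> C i \subset A
      & forall i, (i < r)%N -> join (C i) (P i) \in S].
  elim: r A => [|r IH] A; first by exists (fun=> set0).
  move=> /existsP[B /and3P[BA /IH[C [Chomo CB CS]] BS]].
  exists (fun i => if (i < r)%N then C i else B); split=> [i j|i|i];
    rewrite ?inE ?ltnS.
  - move=> ir jr ij; case: (ltnP j r) => jr'.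
      by rewrite (leq_ltn_trans ij jr'); apply: Chomo; rewrite ?inE //;
        exact: leq_ltn_trans jr'.
    by case: (ltnP i r) => // /CB.
  - by move=> _; case: ifP => // /CB /subset_trans; apply.
  - by move=> ir; case: (ltnP i r) => [/CS//|ri]; have -> : i = r by
      apply/eqP; rewrite eqn_leq ir ri.
have [[A /climb_chain[C [Chomo _ CS]]]|none] :=
    pselect (exists A, climb k.+1 A).
  by right; exists C; split=> [i j|i ik]; [exact: Chomo | exact: CS].
left.
have climb_bound A r : climb r A -> (r <= k)%N.
  move=> c; rewrite leqNgt; apply/negP => kr.
  by apply: none; exists A; exact: climb_le c.
have climb0 A : exists r, climb r A by exists 0%N.
pose h A := ex_maxn (climb0 A) (climb_bound A).
have hP A : climb (h A) A by rewrite /h; case: ex_maxnP.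
have h_max A r : climb r A -> (r <= h A)%N.
  by rewrite /h; case: ex_maxnP => ? _ /[apply].
exists (fun A => join A (P (h A))) => [A B|A].
  rewrite join_subset; apply/andb_idr => AB; apply: P_homo.
  exact/h_max/(climbS _ _ _ AB)/hP.
apply/negP => AS; have /h_max : climb (h A).+1 A.
  by apply/existsP; exists A; apply/and3P; split=> //; exact: hP.
by rewrite ltnn.
Qed.

End Join.

Section Initials.
Context (k : nat).
Implicit Types pi rho : {perm 'I_k}.

(** The first [i] elements in the order [pi 0, pi 1, ...]. *)
Definition initial pi i : {set 'I_k} := [set pi j | j : 'I_k & (j < i)%N].

Lemma mem_initial pi i j : (pi j \in initial pi i) = (j < i)%N.
Proof. by rewrite mem_imset ?inE //; exact: perm_inj. Qed.

Lemma initial_homo pi : {homo initial pi : i j / (i <= j)%N >-> i \subset j}.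
Proof.
move=> i j ij; apply/imsetS/subsetP => x; rewrite !inE => xi.
exact: leq_trans xi ij.
Qed.

Lemma card_initial pi rho i : #|initial pi i| = #|initial rho i|.
Proof. by rewrite !card_imset //; exact: perm_inj. Qed.

Lemma initial_inj pi rho :
  (forall i, (i <= k)%N -> initial pi i = initial rho i) -> pi = rho.
Proof.
move=> eq_initial; apply/permP => j.
have [h eqh] : exists h, pi j = rho h.
  by exists ((rho^-1)%g (pi j)); rewrite permKV.
rewrite eqh.
have := mem_initial pi j.+1 j; have := mem_initial pi j j.
rewrite !eq_initial ?ltn_ord ?(ltnW (ltn_ord j)) // eqh !mem_initial ltnn leqnn.
rewrite ltnS => /negbT; rewrite -leqNgt => jh hj.
by congr (rho _); apply/val_inj/eqP; rewrite eqn_leq hj jh.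
Qed.

(** A permutation is determined by its [k.+1] initial segments, so a class of
    [e] with at most [s] initial segments of each size has at most [s ^ k.+1]
    members, too few for all the classes together to exhaust the [k!]
    permutations. *)
Lemma many_initials (E : finType) (e : {perm 'I_k} -> E) s :
    (#|E| * s ^ k.+1 < k`!)%N ->
  exists x, exists2 i : nat, (i <= k)%N &
    (s < #|[set initial pi i | pi : {perm 'I_k} & e pi == x]|)%N.
Proof.
move=> lt_fact; apply: contrapT => few; move: lt_fact.
rewrite ltnNge -card_Sn => /negP; apply.
rewrite -sum1_card (partition_big e predT) //= -sum_nat_const.
apply: leq_sum => x _; rewrite sum1_card.
pose Fx (i : 'I_k.+1) := [set initial pi i | pi : {perm 'I_k} & e pi == x].
pose chain (pi : {perm 'I_k}) := [ffun i : 'I_k.+1 => initial pi i].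
have chain_inj : injective chain.
  move=> pi rho /ffunP eq_chain; apply: initial_inj => i; rewrite -ltnS => ik.
  by have := eq_chain (Ordinal ik); rewrite !ffunE.
rewrite -(card_image chain_inj); apply: (@leq_trans #|family Fx|).
  apply/subset_leq_card/subsetP => _ /imageP[pi pix ->]; apply/familyP => i.
  by rewrite ffunE; apply: imset_f; rewrite inE.
rewrite card_family -[X in (_ <= s ^ X)%N]card_ord /image_mem cardT.
elim: (enum _) => //= i r IH; rewrite expnS leq_mul // leqNgt.
by apply/negP => si; apply: few; exists x, i; rewrite // -ltnS.
Qed.

End Initials.

Lemma enum_injection (T : finType) (A : {set T}) w : (w <= #|A|)%N ->
  exists2 f : 'I_w -> T, injective f & forall i, f i \in A.
Proof.
move=> wA; exists (fun i => enum_val (widen_ord wA i)) => [i j|i].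
  by move=> /enum_val_inj /(congr1 val) /= ij; exact: val_inj.
exact: enum_valP.
Qed.

(** Pigeonhole on the traces of the two ends of the chains on the old elements;
    on the new elements the ends have traces [set0] and [setT] for every
    permutation. Within one class, the chain members whose new elements are
    different initial segments of the same size form the antichain. *)
Lemma cube_or_spindle m k s (S : {set {set 'I_(m + k)}}) :
    (4 ^ m * s ^ k.+1 < k`!)%N ->
  cube_avoiding m S \/ exists b c, exists a : 'I_s.+1 -> _, spindle S b c a.
Proof.
move=> lt_fact; have [?|no_cube] := pselect (cube_avoiding m S); first by left.
right.
have /choice[A AP] (pi : {perm 'I_k}) : exists A : nat -> {set 'I_m},
    {in [pred i | (i <= k)%N] &, {homo A : i j / (i <= j)%N >-> i \subset j}} /\
    forall i, (i <= k)%N -> join (A i) (initial pi i) \in S.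
  by have [/no_cube|] := cube_or_chain S (@initial_homo k pi).
pose e pi := (A pi 0%N, A pi k).
have [|[x y] [i ik many]] := @many_initials k _ e s.
  by rewrite card_prod -cardsT -powersetT card_powerset cardsT card_ord -expnMn.
have [f f_inj fP] := enum_injection many.
have /choice[pi piP] j : exists pi, e pi = (x, y) /\ f j = initial pi i.
  by have /imsetP[pi] := fP j; rewrite inE => /eqP ? ?; exists pi.
have ends j : A (pi j) 0%N = x /\ A (pi j) k = y by have [[-> ->]] := piP j.
exists (join x (initial (pi ord0) 0)), (join y (initial (pi ord0) k)).
exists (fun j => join (A (pi j) i) (f j)); split.
- have [<- <-] := ends ord0; split=> [| |j]; try exact: (AP _).2.
  by rewrite (piP j).2; apply: (AP _).2.
- move=> j; rewrite join_subset -(ends j).1 (AP _).1 ?inE //=.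
  by apply/subsetP => z /imsetP[h]; rewrite inE.
- move=> j; rewrite join_subset -(ends j).2 (AP _).1 ?inE //=.
  by apply/subsetP => z _; rewrite -(permKV (pi ord0) z) mem_initial.
move=> j j'; rewrite join_subset => /andP[_ sub]; apply: f_inj; apply/eqP.
by rewrite eqEcard sub !(piP _).2 (card_initial (pi j') (pi j)) leqnn.
Qed.

(** * Gluing spindles *)

(** The bottom [b] is not part of the multipartite poset: it is the place where
    the next spindle is attached. *)
Definition layered w l N (S : {set {set 'I_N}}) : Prop :=
  exists2 b, b \in S & exists F : nat -> 'I_w -> {set 'I_N},
    [/\ forall i x, (i < l)%N -> F i x \in S,
        forall i x, (i < l)%N -> b \subset F i x,
        forall i j x y, (i < j < l)%N -> F i x \subset F j y
      & forall i, (i < l)%N -> antichain (F i)].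

Lemma layered_preim w l M N (f : {set 'I_M} -> {set 'I_N})
    (S : {set {set 'I_N}}) : {mono f : A B / A \subset B} ->
  layered w l (f @^-1: S) -> layered w l S.
Proof.
move=> f_mono [b]; rewrite inE => bS [F [FS bF FF Fanti]].
exists (f b) => //; exists (fun i x => f (F i x)); split.
- by move=> i x /FS-/(_ x); rewrite inE.
- by move=> i x il; rewrite f_mono bF.
- by move=> i j x y ijl; rewrite f_mono FF.
- by move=> i il x y; rewrite f_mono; exact: Fanti.
Qed.

(** Recolouring: [T] is the set of tops of spindles in [S]. Since [S :\: T]
    contains no spindle, a cube avoids it, and inside that cube every element of
    [S] lies in [T]. A layered family in [T] has its bottom in [T], so there is a
    spindle of [S] beneath it, whose antichain becomes the new lowest layer. *)
Lemma layeredS w l n M N :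
    (forall S : {set {set 'I_M}}, cube_avoiding n S \/ layered w l S) ->
    (forall S : {set {set 'I_N}}, cube_avoiding M S \/
       exists b c, exists a : 'I_w -> _, spindle S b c a) ->
  forall S : {set {set 'I_N}}, cube_avoiding n S \/ layered w l.+1 S.
Proof.
move=> cube_or_layered cube_or_spd S.
pose T := [set c in S | `[< exists b, exists a : 'I_w -> _, spindle S b c a >]].
have [[f f_mono fST]|[b [c [a [[bS cS aS] ba ac anti_a]]]]] :=
    cube_or_spd (S :\: T); last first.
  have ST X : X \in S :\: T -> X \in S by rewrite inE => /andP[].
  suff cT : c \in T by move: cS; rewrite inE cT.
  rewrite inE (ST _ cS); apply/asboolP; exists b, a.
  split=> //; split=> [||j]; apply: ST => //; exact: aS.
have f_preim A : f A \in S -> f A \in T.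
  by move=> fAS; have := fST A; rewrite inE fAS andbT negbK.
have [[g g_mono gT]|/(layered_preim f_mono)] := cube_or_layered (f @^-1: T).
  left; exists (f \o g) => [A B|A]; first by rewrite /= f_mono g_mono.
  by apply/negP => /f_preim fT; have := gT A; rewrite inE fT.
move=> [c cT [F [FT cF FF Fanti]]]; right.
have TS X : X \in T -> X \in S by rewrite inE => /andP[].
move: (cT); rewrite inE => /andP[_ /asboolP[b [a [[bS cS aS] ba ac anti_a]]]].
exists b => //; exists (fun i => if i is i'.+1 then F i' else a); split.
- by move=> [|i] x // /FT-/(_ x)/TS.
- move=> [|i] x // il; apply: subset_trans (cF i x il).
  exact: subset_trans (ba x) (ac x).
- move=> [|i] [|j] x y //; last exact: FF.
  by move=> jl; exact: subset_trans (ac x) (cF _ _ jl).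
- by move=> [|i] //; exact: Fanti.
Qed.

Lemma cube_or_layered s (k : nat -> nat) n l :
    (forall m, (n <= m)%N -> (4 ^ m * s ^ (k m).+1 < (k m)`!)%N) ->
  let N := iter l (fun m => m + k m)%N n in
  forall S : {set {set 'I_N}}, cube_avoiding n S \/ layered s.+1 l S.
Proof.
move=> k_large.
have n_le i : (n <= iter i (fun m => m + k m)%N n)%N.
  by elim: i => //= i IH; rewrite (leq_trans IH) ?leq_addr.
elim: l => [|l IH] /= S; last first.
  apply: layeredS IH _ S => S; apply: cube_or_spindle; exact: k_large.
have [->|/set0Pn[b bS]] := eqVneq S set0.
  by left; exists id => // A; rewrite inE.
by right; exists b => //; exists (fun _ _ => b); split.
Qed.

(** The layers of a layered family are only weakly nested. But if a set of a later
    layer were contained in a set of an earlier one, it would be contained in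
    every set of its own layer, which an antichain of at least two sets
    forbids: this is why the layers have [s.+1 >= 2] sets. *)
Lemma layered_copy s l N (t : 'I_l -> nat) (S : {set {set 'I_N}}) :
    (0 < s)%N -> (forall i, t i <= s)%N -> layered s.+1 l S ->
  exists2 f : multipartite t -> boolean_lattice N,
    {mono f : x y / (x <= y)%O} & forall x, f x \in S.
Proof.
move=> s_gt0 ts [b bS [F [FS bF FF Fanti]]].
have t_le i : (t i <= s.+1)%N by exact/leqW/ts.
pose f (x : multipartite t) : boolean_lattice N :=
  F (tag x) (widen_ord (t_le (tag x)) (tagged x)).
exists f => [[i x] [j y]|[i x]]; last exact: FS.
rewrite le_multipartiteE le_boolean_latticeE /f /=.
case: (ltngtP i j) => [ij|ji|/val_inj ij].
- by rewrite orbT FF // ij ltn_ord.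
- rewrite orbF; apply/idP/eqP => [sub|[ij _]]; last by rewrite ij ltnn in ji.
  set u := widen_ord _ _ in sub.
  have [v vu] : exists v : 'I_s.+1, v != u.
    case: (eqVneq u ord0) => [->|u0]; last by exists ord0; rewrite eq_sym.
    by exists ord_max; rewrite -val_eqE /= -lt0n.
  have /Fanti uv : F i u \subset F i v.
    by apply: subset_trans sub _; apply: FF; rewrite ji ltn_ord.
  by rewrite uv ?eqxx // in vu.
- case: j / ij y => y; rewrite orbF -tag_eqE /tag_eq eqxx tagged_asE /=.
  apply/idP/eqP => [/(Fanti _ (ltn_ord i))/(congr1 val) xy|->]; last by [].
  exact: val_inj.
Qed.

Lemma poset_ramsey_le d1 (P : finPOrderType d1) d2 (Q : finPOrderType d2) N :
  (0 < N)%N -> ramsey_arrow P Q N -> (poset_ramsey P Q <= N)%N.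
Proof.
rewrite /poset_ramsey; case: ex_minnP => M _ minM N_gt0 arrow.
by apply: minM; apply/asboolP.
Qed.

Lemma poset_ramsey_multipartite_le s (k : nat -> nat) n l (t : 'I_l -> nat) :
    (0 < n)%N -> (0 < s)%N -> (forall i, t i <= s)%N ->
    (forall m, (n <= m)%N -> (4 ^ m * s ^ (k m).+1 < (k m)`!)%N) ->
  (poset_ramsey (multipartite t) (boolean_lattice n)
     <= iter l (fun m => m + k m) n)%N.
Proof.
move=> n_gt0 s_gt0 ts k_large; apply: poset_ramsey_le => [|c].
  by elim: l {t ts} => //= l IH; rewrite ltn_addr.
pose S : {set {set 'I__}} := [set X | if c X is Blue then true else false].
have SP X : X \in S -> c X = Blue by rewrite inE; case: (c X).
have [[f f_mono fS]|/(layered_copy s_gt0 ts)[f f_mono fS]] :=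
    cube_or_layered (l := l) k_large S.
  right; eexists.
    by exists f => // A B; rewrite !le_boolean_latticeE f_mono.
  by move=> _ /imsetP[A _ ->]; have := fS A; rewrite inE; case: (c (f A)).
left; eexists; first by exists f.
by move=> _ /imsetP[x _ ->]; exact: SP.
Qed.

Local Open Scope classical_set_scope.
Local Open Scope ring_scope.

(** * Logarithms *)

Section Log2.
Context (R : realType).
Implicit Types x y : R.

Lemma ln2_gt0 : 0 < ln 2 :> R.
Proof. by apply: ln_gt0; lra. Qed.

Lemma ln2_ge_half : 1 / 2 <= ln 2 :> R.
Proof.
have h : 1 + - (1 / 2) = 2^-1 :> R by field.
have : ln (1 + - (1 / 2)) <= - (1 / 2) :> R by apply: le_ln1Dx; lra.
rewrite h lnV ?posrE; lra.
Qed.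

Lemma log2M x y : 0 < x -> 0 < y -> log2 (x * y) = log2 x + log2 y.
Proof. by move=> x0 y0; rewrite /log2 lnM ?posrE // mulrDl. Qed.

Lemma log2X x n : 0 < x -> log2 (x ^+ n) = n%:R * log2 x.
Proof. by move=> x0; rewrite /log2 lnXn // -(mulr_natl (ln x)) mulrA. Qed.

Lemma log2_2 : log2 2 = 1 :> R.
Proof. by rewrite /log2 divff // gt_eqF // ln2_gt0. Qed.

Lemma log2_le x y : 0 < x -> x <= y -> log2 x <= log2 y.
Proof.
move=> x0 xy; rewrite /log2 ler_pM2r ?invr_gt0 ?ln2_gt0 // ler_ln ?posrE //.
exact: lt_le_trans xy.
Qed.

Lemma log2_lt_cancel x y : 0 < x -> 0 < y -> log2 x < log2 y -> x < y.
Proof.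
by move=> x0 y0; rewrite /log2 ltr_pM2r ?invr_gt0 ?ln2_gt0 // ltr_ln ?posrE.
Qed.

Lemma log2_gt0 x : 1 < x -> 0 < log2 x.
Proof. by move=> x1; rewrite divr_gt0 ?ln2_gt0 // ln_gt0. Qed.

(** A weak form of Stirling's bound: [k ^ k / k!] is one term of the exponential
    series at [k], so that [ln k! >= k ln k - k]; the factor [2] bounds
    [1 / ln 2]. *)
Lemma log2_fact_ge k : (0 < k)%N ->
  k%:R * log2 k%:R - 2 * k%:R <= log2 (k`!%:R : R).
Proof.
move=> k0; have k0R : 0 < k%:R :> R by rewrite ltr0n.
have f0 : 0 < k`!%:R :> R by rewrite ltr0n fact_gt0.
have : k%:R ^+ k / k`!%:R <= expR (k%:R : R).
  have := @expR_ge1Dxn R k%:R k.-1 (ltW k0R); rewrite prednK //; lra.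
rewrite -ler_ln ?posrE ?expR_gt0 ?divr_gt0 ?exprn_gt0 //.
rewrite expRK ln_div ?posrE ?exprn_gt0 // lnXn // -(mulr_natl (ln _)) => le_k.
have c0 := ln2_gt0; have c1 := ln2_ge_half.
rewrite /log2 -(ler_pM2r c0) mulrBl mulrA !divfK ?gt_eqF //.
have : k%:R * (1 / 2) <= k%:R * ln 2 :> R by apply: ler_wpM2l => //; exact: ltW.
lra.
Qed.

Lemma log2_sublinear (e : R) : 0 < e -> \forall x \near +oo, log2 x <= e * x.
Proof.
move=> e0; have c0 := ln2_gt0.
(* [ln x < x] is applied to [d * x]: the slope becomes [d] at the price of the
   constant [- ln d], which is at most [d * x] for large [x]. *)
set d := e * ln 2 / 2.
have d0 : 0 < d by rewrite !mulr_gt0 // invr_gt0.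
near=> x.
have x0 : 0 < x by near: x; exact: (nbhs_pinfty_gt (num_real _)).
have dx : - ln d / d <= x by near: x; exact: (nbhs_pinfty_ge (num_real _)).
have := ln_sublinear (mulr_gt0 d0 x0); rewrite lnM ?posrE // => lndx.
rewrite /log2 ler_pdivrMr //; rewrite ler_pdivrMr // in dx.
have -> : e * x * ln 2 = 2 * (d * x) by rewrite /d; field.
lra.
Unshelve. all: by end_near. Qed.

Lemma log2_natr_cvgy : log2 (n%:R : R) @[n --> \oo] --> +oo.
Proof.
apply/cvgryPge => A; near=> n.
have : expR (A * ln 2) <= n%:R by near: n; exact: nbhs_infty_ger.
have c0 := ln2_gt0.
move=> eA; rewrite /log2 ler_pdivlMr // -[leLHS]expRK ler_ln ?posrE ?expR_gt0 //.
exact: lt_le_trans (expR_gt0 _) eA.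
Unshelve. all: by end_near. Qed.

Lemma log2_natr_sublinear (e : R) : 0 < e ->
  \forall n \near \oo, log2 (n%:R : R) <= e * n%:R.
Proof. by move=> e0; exact: (@cvgr_idn R _ (log2_sublinear e0)). Qed.

End Log2.

(** * The growth rate of the iteration *)

Section Growth.
Context (R : realType).

(** With [k ~ (2 + d) m / log n] new elements, [log k!] is about
    [k log n ~ (2 + d) m], which exceeds the [2 m] bits spent on the ends of the
    chains. The margin [d m] absorbs three losses, each of at most [d / 24 * L]
    per new element, where [L = log n]: the factor [s], the difference between
    [log k] and [L], and the correction [2] in Stirling's bound. As [m] is bounded
    only from below, one [n] serves for all the steps of the iteration. *)
Lemma step_large (d : R) (n m k s : nat) :
  0 < d <= 1 -> (0 < n)%N -> (0 < s)%N -> (n <= m)%N ->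
  48 / d <= log2 n%:R -> log2 n%:R <= d / 2 * n%:R ->
  log2 (log2 n%:R) <= d / 24 * log2 n%:R ->
  log2 s%:R <= d / 24 * log2 n%:R ->
  m%:R * (2 + d) / log2 n%:R < k.+1%:R ->
  (4 ^ m * s ^ k.+1 < k`!)%N.
Proof.
move=> /andP[d0 d1] n0 s0 nm; set L := log2 n%:R => L_large Ln LL sL k_large.
have L48 : 48 <= L.
  by apply: le_trans L_large; rewrite ler_pdivlMr // ger_pMr //; lra.
have L0 : 0 < L by lra.
have dL : 48 <= d * L by rewrite mulrC -ler_pdivrMr.
have n0R : 0 < n%:R :> R by rewrite ltr0n.
have nmR : n%:R <= m%:R :> R by rewrite ler_nat.
have dn_m : d * n%:R <= d * m%:R :> R by rewrite ler_pM2l.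
have Lm : L <= d / 2 * m%:R by lra.
have k_gt : m%:R * (2 + d) < (k%:R + 1) * L.
  by move: k_large; rewrite -(natr1 k) ltr_pdivrMr.
have dm0 : 0 < d * m%:R by apply: mulr_gt0 => //; lra.
have k_ge : m%:R <= k%:R * L by nra.
have k0 : (0 < k)%N.
  rewrite lt0n; apply/eqP => k0; move: k_ge; rewrite k0 mul0r; lra.
have k0R : 0 < k%:R :> R by rewrite ltr0n.
have s0R : 0 < s%:R :> R by rewrite ltr0n.
have log_k : L - d / 24 * L <= log2 k%:R.
  have : log2 n%:R <= log2 (k%:R * L).
    by apply: log2_le => //; exact: le_trans nmR k_ge.
  by rewrite log2M // -/L; lra.
have fact_k := log2_fact_ge R k0.
suff : (4 ^ m * s ^ k.+1)%:R < k`!%:R :> R by rewrite ltr_nat.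
have pow0 : 0 < (4 ^ m * s ^ k.+1)%:R :> R.
  by rewrite ltr0n muln_gt0 !expn_gt0 s0.
apply: log2_lt_cancel => //; first by rewrite ltr0n fact_gt0.
apply: lt_le_trans fact_k.
rewrite natrM !natrX log2M ?exprn_gt0 // !log2X //.
have -> : log2 4 = 2 :> R.
  have -> : 4 = 2 ^+ 2 :> R by rewrite -natrX.
  by rewrite log2X // log2_2 mulr1.
have ks : k.+1%:R * log2 s%:R <= (k%:R + 1) * (d / 24 * L).
  by rewrite -(natr1 k) ler_pM2l // addr_gt0.
have kk : k%:R * (L - d / 24 * L) <= k%:R * log2 k%:R by rewrite ler_pM2l.
(* The three losses leave [1 - 3 * (d / 24) = 1 - d / 8] of the main term; by
   [dL] the correction [2] is at most [d / 24 * L]. *)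
have k_dL : k%:R * 48 <= k%:R * (d * L) by rewrite ler_pM2l.
have key : (m%:R * (2 + d) - L) * (1 - d / 8) <= k%:R * L * (1 - d / 8).
  by rewrite ler_pM2r; lra.
have dd : d * (d * m%:R) <= d * m%:R by rewrite ger_pMl.
lra.
Qed.

Lemma iter_growth (x : R) (k : nat -> nat) n l : 0 <= x ->
  (forall m, (k m)%:R <= m%:R * x) ->
  (iter l (fun m => m + k m) n)%N%:R <= n%:R * (1 + x) ^+ l.
Proof.
move=> x0 kx; elim: l => [|l IH]; first by rewrite expr0 mulr1.
rewrite iterS natrD; set N := iter _ _ _ in IH *.
apply: (@le_trans _ _ (N%:R * (1 + x))).
  by rewrite mulrDr mulr1 lerD2l.
by rewrite exprSr mulrA ler_pM2r //; lra.
Qed.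

Lemma bernoulli_ge (x : R) l : 0 <= x -> 1 + l%:R * x <= (1 + x) ^+ l.
Proof.
move=> x0; elim: l => [|l IH]; first by rewrite mul0r addr0.
rewrite exprSr -(natr1 l); apply: (@le_trans _ _ ((1 + l%:R * x) * (1 + x))).
  have : 0 <= l%:R * x * x by rewrite !mulr_ge0.
  lra.
by rewrite ler_wpM2r //; lra.
Qed.

(** A converse to Bernoulli's inequality: [(1 + x) ^ l <= 1 / (1 - l x)] when
    [l x < 1], so [(1 + x) ^ l - 1] is asymptotic to [l x] as [l x] tends
    to [0]. *)
Lemma bernoulli_le (x : R) l : 0 <= x -> (1 + x) ^+ l * (1 - l%:R * x) <= 1.
Proof.
move=> x0; elim: l => [|l IH]; first by rewrite mul0r subr0 mulr1.
apply: le_trans IH; rewrite exprSr -mulrA ler_wpM2l ?exprn_ge0 //; first lra.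
have : 0 <= (l%:R + 1) * x * x by rewrite !mulr_ge0 // addr_ge0.
rewrite -(natr1 l); lra.
Qed.

End Growth.

Lemma poset_ramsey_eventually_le (R : realType) (l : nat -> nat)
    (t : forall n : nat, 'I_(l n) -> nat) (d : R) :
  (forall n : nat, (0 < n)%N -> (0 < l n)%N) ->
  (forall n : nat, (0 < n)%N -> forall i : 'I_(l n), (0 < t n i)%N) ->
  log2 ((\max_(i < l n) t n i)%N%:R : R) / log2 (n%:R : R)
    @[n --> \oo] --> (0 : R) ->
  0 < d <= 1 -> \forall n \near \oo,
    (poset_ramsey (multipartite (t n)) (boolean_lattice n))%:R
      <= n%:R * (1 + (2 + d) / log2 n%:R) ^+ l n :> R.
Proof.
move=> l_gt0 t_gt0 t_sub /andP[d0 d1]; have d24 : 0 < d / 24 by lra.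
have L_ge (A : R) : \forall n \near \oo, A <= log2 n%:R.
  exact: (cvgry_ge (@log2_natr_cvgy R)).
near=> n.
have n0 : (0 < n)%N by near: n; exact: nbhs_infty_gt.
have L1 : 1 <= log2 n%:R :> R by near: n; exact: L_ge.
have L0 : 0 < log2 n%:R :> R by lra.
pose s := (\max_(i < l n) t n i)%N.
have ts i : (t n i <= s)%N by exact: leq_bigmax.
have s0 : (0 < s)%N by apply: leq_trans (ts (Ordinal (l_gt0 n n0))); exact: t_gt0.
have sL : log2 (s%:R : R) <= d / 24 * log2 n%:R.
  rewrite -ler_pdivrMr //; apply: le_trans (ler_norm _) _.
  by rewrite /s; near: n; exact: (cvgr0_norm_le _ t_sub).
pose k m := Num.truncn (m%:R * ((2 + d) / log2 (n%:R : R))).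
have x0 : 0 <= (2 + d) / log2 (n%:R : R) by rewrite divr_ge0 //; lra.
apply: le_trans (iter_growth n (l n) x0 (k := k) _); last first.
  by move=> m; rewrite /k truncn_le mulr_ge0.
rewrite ler_nat; apply: (poset_ramsey_multipartite_le n0 s0 ts) => m nm.
apply: (@step_large _ d n) => //; first by rewrite d0.
- by near: n; exact: L_ge.
- by near: n; apply: log2_natr_sublinear; rewrite divr_gt0.
- by near: n; exact: (@log2_natr_cvgy R _ (log2_sublinear d24)).
- by rewrite -mulrA /k truncnS_gt.
Unshelve. all: by end_near. Qed.

Theorem theorem1 (R : realType) (l : nat -> nat)
    (t : forall n : nat, 'I_(l n) -> nat)
    (l_gt0 : forall n : nat, (0 < n)%N -> (0 < l n)%N)
    (t_gt0 : forall n : nat, (0 < n)%N -> forall i : 'I_(l n), (0 < t n i)%N)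
    (l_little_o : (l n)%:R / log2 (n%:R : R) @[n --> \oo] --> (0 : R))
    (t_subpolynomial :
       log2 ((\max_(i < l n) t n i)%N%:R : R) / log2 (n%:R : R)
         @[n --> \oo] --> (0 : R)) :
  exists eps1 eps2 : nat -> R,
    [/\ eps1 n @[n --> \oo] --> (0 : R),
        eps2 n @[n --> \oo] --> (0 : R)
      & forall n : nat, (2 <= n)%N ->
          (poset_ramsey (multipartite (t n)) (boolean_lattice n))%:R
            <= n%:R * (1 + (2 + eps1 n) / log2 n%:R) ^+ l n
            <= n%:R + (2 + eps2 n) * (l n)%:R * n%:R / log2 n%:R].
Proof.
pose r n : R := (poset_ramsey (multipartite (t n)) (boolean_lattice n))%:R.
have r_ge0 n : 0 <= r n by rewrite /r ler0n.
pose L n : R := log2 n%:R.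
have L_gt0 n : (2 <= n)%N -> 0 < L n by move=> n2; rewrite log2_gt0 // ltr1n.
pose root n : R := (r n / n%:R) `^ (l n)%:R^-1.
have rootX n : (2 <= n)%N -> root n ^+ l n = r n / n%:R.
  move=> n2; rewrite -powR_mulrn ?powR_ge0 // -powRrM mulVf ?powRr1 ?divr_ge0 //.
  by rewrite pnatr_eq0 -lt0n l_gt0 // ltnW.
(* The least nonnegative value for which the first inequality holds: this also
   settles the small [n], about which nothing is known. *)
pose eps1 n := Num.max 0 (L n * (root n - 1) - 2).
have eps1_ge0 n : 0 <= eps1 n by rewrite le_max lexx.
pose x n := (2 + eps1 n) / L n.
have x_ge0 n : (2 <= n)%N -> 0 <= x n.
  by move=> n2; rewrite divr_ge0 ?addr_ge0 // ltW ?L_gt0.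
have root_le n : (2 <= n)%N -> root n <= 1 + x n.
  move=> n2; rewrite -lerBlDl ler_pdivlMr ?L_gt0 //.
  have : L n * (root n - 1) - 2 <= eps1 n by rewrite le_max lexx orbT.
  lra.
(* This value turns the second inequality into an equality. *)
pose eps2 n := L n / (l n)%:R * ((1 + x n) ^+ l n - 1) - 2.
have eps1_cvg0 : eps1 n @[n --> \oo] --> (0 : R).
  apply/cvgr0Pnorm_le => e e0; pose d := Num.min e 1.
  have d01 : 0 < d <= 1 by rewrite lt_min e0 ltr01 ge_min lexx orbT.
  have := poset_ramsey_eventually_le l_gt0 t_gt0 t_subpolynomial d01.
  move=> bound; near=> n.
  have n2 : (2 <= n)%N by near: n; exact: nbhs_infty_ge.
  have n0 : 0 < n%:R :> R by rewrite ltr0n ltnW.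
  have /andP[d0 d1] := d01.
  rewrite ger0_norm // ge_max ltW //=.
  apply: (@le_trans _ _ d); last by rewrite ge_min lexx.
  rewrite lerBlDr -ler_pdivlMl ?L_gt0 // lerBlDl.
  have y0 : 0 <= 1 + (L n)^-1 * (d + 2).
    by rewrite addr_ge0 // mulr_ge0 ?invr_ge0 ?addr_ge0 // ltW // L_gt0.
  rewrite -(@ler_pXn2r _ (l n)) ?nnegrE ?powR_ge0 ?l_gt0 1?ltnW //.
  rewrite rootX // ler_pdivrMr // mulrC [X in 1 + X]mulrC [d + 2]addrC.
  by near: n.
have x_cvg0 : (l n)%:R * x n @[n --> \oo] --> (0 : R).
  have -> : (fun n => (l n)%:R * x n) = (fun n => (l n)%:R / L n * (2 + eps1 n)).
    by apply/funext => n; rewrite /x; ring.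
  rewrite -(mul0r (2 + 0)); apply: cvgM => //.
  by apply: cvgD => //; exact: cvg_cst.
exists eps1, eps2; split=> //; last first.
  move=> n n2; rewrite -/(L n) -/(x n) -/(r n).
  have n0 : 0 < n%:R :> R by rewrite ltr0n ltnW.
  have l0 : (l n)%:R != 0 :> R by rewrite pnatr_eq0 -lt0n l_gt0 // ltnW.
  apply/andP; split.
    rewrite -ler_pdivrMl // mulrC -rootX //.
    rewrite ler_pXn2r ?root_le ?nnegrE ?powR_ge0 ?l_gt0 //; first exact: ltnW.
    by rewrite addr_ge0 // x_ge0.
  rewrite /eps2; set u := (1 + x n) ^+ l n.
  have -> : (2 + (L n / (l n)%:R * (u - 1) - 2)) * (l n)%:R * n%:R / L n
            = n%:R * (u - 1).
    by field; rewrite l0 gt_eqF ?L_gt0.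
  lra.
(* [bernoulli_ge] and [bernoulli_le] enclose [eps2]. *)
apply: (@squeeze_cvgr _ _ _ _ eps1
  (fun n => (2 + eps1 n) / (1 - (l n)%:R * x n) - 2)) => //; last first.
  have -> : (0 : R) = (2 + 0) / (1 - 0) - 2 by rewrite addr0 subr0 divr1 subrr.
  apply: cvgB; last exact: cvg_cst.
  apply: cvgM; first by apply: cvgD => //; exact: cvg_cst.
  apply: cvgV; first by rewrite subr0 oner_eq0.
  by apply: cvgB => //; exact: cvg_cst.
near=> n.
have n2 : (2 <= n)%N by near: n; exact: nbhs_infty_ge.
have l0 : 0 < (l n)%:R :> R by rewrite ltr0n l_gt0 // ltnW.
have Ln0 := L_gt0 n n2.
have y1 : (l n)%:R * x n < 1.
  apply: le_lt_trans (ler_norm _) _.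
  by near: n; exact: (cvgr0_norm_lt _ x_cvg0).
have Lxl : L n / (l n)%:R * ((l n)%:R * x n) = 2 + eps1 n.
  by rewrite /x; field; rewrite !gt_eqF.
have lower := bernoulli_ge (l n) (x_ge0 n n2).
have upper := bernoulli_le (l n) (x_ge0 n n2).
have v0 : 0 < L n / (l n)%:R by rewrite divr_gt0.
rewrite /eps2; apply/andP; split.
  rewrite lerBrDr addrC -Lxl ler_pM2l //; lra.
rewrite lerD2r -Lxl -[X in _ <= X]mulrA ler_pM2l // ler_pdivlMr; lra.
Unshelve. all: by end_near. Qed.
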